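(* The pattern $\{(1,2),(2,1),(1,3),(1,4),(2,4),(3,2)\}$ is not $4$-universal.
   Context: Let $L(4)$ be the space of traceless complex $4\times4$ matrices. For a set $I\subseteq\{1,2,3,4\}^2$, let $L_I(4)$ be the subspace of all $X=[x_{ij}]\in L(4)$ with $x_{ij}=0$ for all $(i,j)\in I$. The pattern $I$ is $4$-universal if every matrix in $L(4)$ is unitarily similar (by an element of $\mathrm{U}(4)$) to a matrix in $L_I(4)$. *)

(* Defs.v *)
From HB Require Import structures.
From mathcomp Require Import all_boot all_order all_algebra.
From mathcomp Require Import complex reals.
From mathcomp Require Import spectral.

Set Implicit Arguments.
Unset Strict Implicit.
Unset Printing Implicit Defensive.

Import Order.TTheory GRing.Theory Num.Theory.
Local Open Scope ring_scope.
Local Open Scope sesquilinear_scope.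

Definition traceless (R : realType) (n : nat) : {pred 'M[R[i]]_n} :=
  [pred X | \tr X == 0].

Definition traceless_pattern (R : realType) (n : nat) (I : {set 'I_n * 'I_n}) :
    {pred 'M[R[i]]_n} :=
  [pred X | (X \in @traceless R n) && [forall p in I, X p.1 p.2 == 0]].

Lemma traceless_submod_closed (R : realType) (n : nat) :
  GRing.submod_closed (@traceless R n).
Proof.
split=> [|a X Y]; rewrite !inE ?mxtrace0 // => /eqP tX /eqP tY.
by rewrite linearP /= tX tY mulr0 addr0.
Qed.

Lemma traceless_pattern_submod_closed (R : realType) (n : nat)
    (I : {set 'I_n * 'I_n}) :
  GRing.submod_closed (@traceless_pattern R n I).
Proof.
have [t0 tD] := traceless_submod_closed R n.
split=> [|a X Y].
  by rewrite inE t0 /=; apply/forall_inP => p _; rewrite mxE.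
rewrite !inE => /andP[tX /forall_inP hX] /andP[tY /forall_inP hY].
apply/andP; split; first exact: tD.
apply/forall_inP => p pI.
by rewrite !mxE (eqP (hX p pI)) (eqP (hY p pI)) mulr0 addr0.
Qed.

Definition unitarily_similar (R : realType) (n : nat) (A B : 'M[R[i]]_n) : Prop :=
  exists2 U : 'M[R[i]]_n, U \is unitarymx & B = U *m A *m U^t*.

Definition universal_pattern (R : realType) (n : nat) (I : {set 'I_n * 'I_n}) :
    Prop :=
  forall A : 'M[R[i]]_n, A \in @traceless R n ->
    exists2 B : 'M[R[i]]_n, B \in @traceless_pattern R n I
                          & unitarily_similar A B.

(* Positions are written with the customary indices 1, ..., 4, whereas the
   elements of 'I_4 are 0, ..., 3. *)
Definition pos4 (i j : nat) : 'I_4 * 'I_4 := (inord i.-1, inord j.-1).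

(* Main.v *)
(** The matrix [nilpotent4] is nilpotent of rank 3, so [e_1] is, up to a scalar,
    its only left eigenvector.  If its conjugate [B] by a unitary [U] fits the
    pattern, then the first row of [B] makes the first row of [U] a left
    eigenvector, hence a multiple of [e_1], and the second row of [U] has the
    form [(0, x, y, z)].  The entry (2,1) of [B] gives [y = x + z], and the
    remaining zeros give [(B^2)_22 = (B_22)^2].  With [N = |x|^2 + |z|^2] and
    [p] the product of [x] and the conjugate of [z], this reads
    [p (2 N + 2 Re p) = (N + p)^2], that is [N^2 = |p|^2 = |x|^2 |z|^2],
    which forces [x = z = 0]. *)
Require Import Defs.
From mathcomp Require Import all_boot all_order all_algebra.
From mathcomp Require Import complex reals spectral.
From mathcomp Require Import ring.

Set Implicit Arguments.
Unset Strict Implicit.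
Unset Printing Implicit Defensive.

Import Order.TTheory GRing.Theory Num.Theory.
Local Open Scope ring_scope.
Local Open Scope sesquilinear_scope.

Lemma sum_ord4 (V : nmodType) (F : 'I_4 -> V) :
  \sum_i F i = F (inord 0) + F (inord 1) + F (inord 2) + F (inord 3).
Proof.
rewrite !big_ord_recl big_ord0 addr0 !addrA.
by do !congr (_ + _); congr F; apply/val_inj; rewrite /= inordK.
Qed.

Lemma quadratic_form_eq0 (C : numClosedFieldType) (x z : C) :
  let y := x + z in
  x * z^* * (x * x^* + y * y^* + z * z^*) =
    (x * y^* - x * z^* + y * z^*) ^+ 2 ->
  x = 0 /\ z = 0.
Proof.
rewrite /= !rmorphD /= => h.
(* With a = |x|^2, b = |z|^2, p = x z^*, the two sides of [h] differ by (a + b)^2 - |p|^2, and |p|^2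
   = a b; all terms left are nonnegative. *)
have : (x * x^*) ^+ 2 + (x * x^*) * (z * z^*) + (z * z^*) ^+ 2 = 0.
  by move/esym/eqP: h; rewrite -subr_eq0 => /eqP <-; ring.
have pos (a b : C) : 0 <= a -> 0 <= b -> a ^+ 2 + a * b + b ^+ 2 = 0 ->
    a = 0 /\ b = 0.
  move=> a0 b0 /eqP; rewrite !paddr_eq0 ?addr_ge0 ?mulr_ge0 ?exprn_ge0 //.
  by rewrite !sqrf_eq0 => /andP[/andP[/eqP-> _] /eqP->].
case/(pos _ _ (mul_conjC_ge0 x) (mul_conjC_ge0 z)) => /eqP + /eqP.
by rewrite !mul_conjC_eq0 => /eqP-> /eqP->.
Qed.

(** The zero first row makes e_1 a left eigenvector; the first column (0, 1, -1, 1) is the source of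
    the relation y = x + z. *)
Definition nilpotent4 (C : nzRingType) : 'M[C]_4 :=
  \matrix_(i, j) nth 0 (nth [::]
    [:: [:: 0; 0; 0; 0]; [:: 1; 0; 1; -1]; [:: -1; 0; 0; 1]; [:: 1; 0; 0; 0]]
    i) j.

Lemma mulmx_nilpotent4 (C : nzRingType) m (U : 'M[C]_(m, 4)) i :
  let u k := U i (inord k) in let v := U *m nilpotent4 C in
  [/\ v i (inord 0) = u 1%N - u 2%N + u 3%N, v i (inord 1) = 0,
      v i (inord 2) = u 1%N & v i (inord 3) = u 2%N - u 1%N].
Proof.
by move=> u v; split; rewrite !mxE sum_ord4 !mxE !inordK //=
  !(mulr0, mulr1, mulrN1, add0r, addr0) // addrC.
Qed.

(** Meant for the column of [U^t*] conjugate to the second row of [U], which starts with 0. *)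
Lemma nilpotent4_mulmx (C : nzRingType) n (V : 'M[C]_(4, n)) j :
  V (inord 0) j = 0 ->
  let v k := V (inord k) j in let w := nilpotent4 C *m V in
  [/\ w (inord 0) j = 0, w (inord 1) j = v 2%N - v 3%N,
      w (inord 2) j = v 3%N & w (inord 3) j = 0].
Proof.
by move=> v0 v w; split; rewrite mxE sum_ord4 v0 !mxE !inordK //=
  !(mul0r, mul1r, mulr0, mulN1r, add0r, addr0).
Qed.

Lemma nilpotent4_left_eigen (C : fieldType) (u : 'rV[C]_4) (l : C) :
  u *m nilpotent4 C = l *: u ->
  forall k, (0 < k < 4)%N -> u 0 (inord k) = 0.
Proof.
move=> h; have [] := mulmx_nilpotent4 u 0; rewrite h !mxE.
set u0 := u 0 _; set u1 := u 0 _; set u2 := u 0 _; set u3 := u 0 _.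
move=> e0 e1 e2 e3.
have [l0|lN0] := eqVneq l 0.
  move: e0 e2 e3; rewrite l0 !mul0r => e0 e2 e3.
  have u1E : u1 = 0 by [].
  have u2E : u2 = 0 by move/esym: e3; rewrite u1E subr0.
  have u3E : u3 = 0 by move/esym: e0; rewrite u1E u2E subr0 add0r.
  by case=> [|[|[|[|]]]].
(* For nonzero [l] the zero second column of the matrix kills [u1], and [l * u2], [l * u3] are
   combinations of earlier entries. *)
have cancel x : l * x = 0 -> x = 0 by move/eqP; rewrite mulf_eq0 (negPf lN0) => /eqP.
have u1E : u1 = 0 := cancel _ e1.
have u2E : u2 = 0 by apply: cancel; rewrite e2.
have u3E : u3 = 0 by apply: cancel; rewrite e3 u1E u2E subr0.
by case=> [|[|[|[|]]]].
Qed.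

Theorem proposition7p2 (R : realType) :
  ~ universal_pattern R
      [set pos4 1 2; pos4 2 1; pos4 1 3; pos4 1 4; pos4 2 4; pos4 3 2].
Proof.
pose M := nilpotent4 R[i].
move=> /(_ M) [].
  by rewrite inE /mxtrace sum_ord4 !mxE !inordK //= !addr0.
move=> B; rewrite inE => /andP[_ /forall_inP hB] [U Uunit BE].
have B0 p : p \in [set pos4 1 2; pos4 2 1; pos4 1 3; pos4 1 4; pos4 2 4; pos4 3 2]
    -> B p.1 p.2 = 0 by move/hB/eqP.
have B01 : B (inord 0) (inord 1) = 0 by apply: (B0 (pos4 1 2)); rewrite !inE eqxx ?orbT.
have B02 : B (inord 0) (inord 2) = 0 by apply: (B0 (pos4 1 3)); rewrite !inE eqxx ?orbT.
have B03 : B (inord 0) (inord 3) = 0 by apply: (B0 (pos4 1 4)); rewrite !inE eqxx ?orbT.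
have B10 : B (inord 1) (inord 0) = 0 by apply: (B0 (pos4 2 1)); rewrite !inE eqxx ?orbT.
have B13 : B (inord 1) (inord 3) = 0 by apply: (B0 (pos4 2 4)); rewrite !inE eqxx ?orbT.
have B21 : B (inord 2) (inord 1) = 0 by apply: (B0 (pos4 3 2)); rewrite !inE eqxx ?orbT.
have UU : U *m U^t* = 1%:M by exact/unitarymxP.
have UU' : U^t* *m U = 1%:M by exact: mulmx1C.
have BU : B *m U = U *m M by rewrite BE -mulmxA UU' mulmx1.
(* In this factorization the entry (2,2) of B^2 involves only the second row of [U]. *)
have BB : B *m B = (U *m M) *m (M *m U^t*).
  by rewrite {1}BE -!mulmxA; congr (_ *m (_ *m _)); rewrite BE !mulmxA UU' mul1mx.
have UUE i j : \sum_k U i k * (U j k)^* = (i == j)%:R.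
  have /matrixP/(_ i j) := UU; rewrite !mxE => <-.
  by apply: eq_bigr => k _; rewrite !mxE.
have U0 k : (0 < k < 4)%N -> U (inord 0) (inord k) = 0.
  have /nilpotent4_left_eigen h :
      row (inord 0) U *m M = B (inord 0) (inord 0) *: row (inord 0) U.
    rewrite -row_mul -BU; apply/rowP => j.
    by rewrite !mxE sum_ord4 B01 B02 B03 !mul0r !addr0.
  by move/h; rewrite mxE.
have U00 : U (inord 0) (inord 0) != 0.
  apply/eqP => U00; have := UUE (inord 0) (inord 0).
  rewrite sum_ord4 U00 !U0 // !mul0r !addr0 eqxx => /esym/eqP.
  by rewrite oner_eq0.
(* The other rows of [U] are orthogonal to its first row, a nonzero multiple of e_1. *)
have Uk0 k : (0 < k < 4)%N -> U (inord k) (inord 0) = 0.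
  move=> /andP[k0 k4]; have := UUE (inord k) (inord 0).
  rewrite sum_ord4 (U0 1%N) // (U0 2%N) // (U0 3%N) // conjC0 !mulr0 !addr0.
  rewrite -val_eqE /= !inordK // (gtn_eqF k0) => /eqP.
  by rewrite mulf_eq0 conjC_eq0 (negPf U00) orbF => /eqP.
have [c0 c1 c2 c3] := mulmx_nilpotent4 U (inord 1).
have V0 : U^t* (inord 0) (inord 1) = 0 by rewrite !mxE Uk0 // conjC0.
have [d0 d1 d2 d3] := nilpotent4_mulmx V0.
set x := U (inord 1) (inord 1) in c0 c2 c3 *.
set y := U (inord 1) (inord 2) in c0 c2 c3 *.
set z := U (inord 1) (inord 3) in c0 c2 c3 *.
have yE : y = x + z.
  have /matrixP/(_ (inord 1) (inord 0)) := BU.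
  rewrite c0 mxE sum_ord4 B10 B13 !mul0r !Uk0 // !mulr0 !addr0 => /esym/eqP.
  by rewrite addrAC subr_eq0 => /eqP.
have nrm : x * x^* + y * y^* + z * z^* = 1.
  by have := UUE (inord 1) (inord 1); rewrite sum_ord4 Uk0 // mul0r add0r eqxx.
have b11 : B (inord 1) (inord 1) = x * y^* - x * z^* + y * z^*.
  rewrite BE -mulmxA mxE sum_ord4 Uk0 // d1 d2 d3 !mxE -/x -/y -/z; ring.
(* The zeros (2,1), (2,4), (3,2) of [B] leave only the square of B_22 in (B^2)_22; on the other side
   only the product of [c2] and [d2] survives. *)
have sq : x * z^* = B (inord 1) (inord 1) ^+ 2.
  have /matrixP/(_ (inord 1) (inord 1)) := BB.
  rewrite mxE sum_ord4 B10 B13 B21 [in RHS]mxE sum_ord4 c1 c2 c3 d0 d2 d3 !mxE -/z.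
  by rewrite !(mul0r, mulr0, add0r, addr0) -expr2 => <-.
(* Since the second row of [U] has norm 1, inserting the factor |x|^2 + |y|^2 + |z|^2 makes [sq]
   homogeneous. *)
have [x0 z0] : x = 0 /\ z = 0.
  by apply: quadratic_form_eq0; rewrite -yE nrm mulr1 -b11.
move: nrm; rewrite yE x0 z0 !(mul0r, addr0) => /esym/eqP.
by rewrite oner_eq0.
Qed.
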